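(* Let $\boldsymbol\alpha$ be a fixed static allocation in the setting described in the context. Then $$\mathrm{LDR}_{\mathrm{FS}}:=\liminf_{n\to\infty}-\frac1n\log\mathrm{P}\left(i^*_n\neq\{i^*\}\right)\;\ge\;\min_{j\ne i^*}\mathrm{LDR}_{j,i^*},\qquad\text{where } \mathrm{LDR}_{j,i^*}:=\min_{\mathbf M\in\mathcal A_j}\sum_{(i,\theta_b)\in I(\mathbf M)}G_i(\theta_b).$$
   Context: There are $k\ge2$ solutions and $B$ parameter values $\theta_1,\dots,\theta_B$ with probabilities $p_1,\dots,p_B\ge0$, $\sum_bp_b=1$. For each $i,b$, $y_i(\theta_b)\in\mathbb R$ is the mean simulation output of solution $i$ at $\theta_b$. For each $b$, $i^b=\arg\min_iy_i(\theta_b)$ is assumed unique, and the most probable best $i^*=\arg\max_{1\le i\le k}\sum_bp_b\mathbf 1\{i=i^b\}$ is assumed unique. Simulation outputs at $(i,\theta_b)$ are i.i.d. $N(y_i(\theta_b),\lambda_i^2(\theta_b))$ with known $\lambda_i(\theta_b)>0$, independent across pairs. A static allocation is $\boldsymbol\alpha$ with $\alpha_i(\theta_b)\ge0$, $\sum_{i,b}\alpha_i(\theta_b)=1$; after total budget $n$, pair $(i,\theta_b)$ has $N_i^n(\theta_b)$ replications with $N_i^n(\theta_b)/n\to\alpha_i(\theta_b)$ and $N_i^n(\theta_b)\to\infty$. Let $\mu_{i,n}(\theta_b)$ be the sample mean at $(i,\theta_b)$, $i^b_n=\arg\min_i\mu_{i,n}(\theta_b)$, and $i^*_n$ the set of maximizers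 of $i\mapsto\sum_bp_b\mathbf 1\{i=i^b_n\}$ (so a tie counts as $i^*_n\ne\{i^*\}$). Let $\mathcal M=\{\mathbf M\in\{0,1\}^{k\times B}:\mathbf M^\top\mathbf 1_k=\mathbf 1_B\}$ with entries $m_{i,b}$. For $\mathbf M\in\mathcal M$ define $d_j(\mathbf M)=\sum_bp_bm_{i^*,b}-\sum_bp_bm_{j,b}$, $I(\mathbf M)=\{(i,\theta_b):m_{i,b}=1,i\ne i^b\}$, and for $j\ne i^*$, $\mathcal A_j=\{\mathbf M\in\mathcal M:d_j(\mathbf M)\le0\}$. For $i\ne i^b$, $$G_i(\theta_b)=\frac{(y_i(\theta_b)-y_{i^b}(\theta_b))^2}{2\left(\lambda_i^2(\theta_b)/\alpha_i(\theta_b)+\lambda_{i^b}^2(\theta_b)/\alpha_{i^b}(\theta_b)\right)},$$ with $G_i(\theta_b)=0$ if $\alpha_i(\theta_b)=0$ or $\alpha_{i^b}(\theta_b)=0$. *)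

(* Defs.v *)
From HB Require Import structures.
From mathcomp Require Import all_boot all_order all_algebra.
From mathcomp Require Import all_classical all_reals all_analysis.
Set Implicit Arguments. Unset Strict Implicit. Unset Printing Implicit Defensive.
Import Order.TTheory GRing.Theory Num.Theory.
Import numFieldNormedType.Exports.
Local Open Scope classical_set_scope.
Local Open Scope ring_scope.

Definition mutually_independent {d} {T : measurableType d} {R : realType}
  (P : probability T R) (I : eqType) (X : I -> T -> R) : Prop :=
  forall (s : seq I) (A : I -> set R), uniq s -> (forall i, measurable (A i)) ->
    P (\bigcap_(i in [set` s]) (X i @^-1` A i)) =
    (\prod_(i <- s) P (X i @^-1` A i))%E.

Definition normally_distributed {d} {T : measurableType d} {R : realType}
  (P : probability T R) (X : T -> R) (m s : R) : Prop :=
  measurable_fun setT X /\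
  forall A : set R, measurable A -> P (X @^-1` A) = normal_prob m s A.

Definition sample_mean {T : Type} {R : realType} (Xr : nat -> T -> R) (N : nat)
  (w : T) : R := (\sum_(r < N) Xr r w) / N%:R.

(* i^b_n : an empirical best solution at theta_b (argmin of sample means; ties
   have probability zero and are broken by the fintype arg min, default i0). *)
Definition emp_best {k : nat} {R : realType} (i0 : 'I_k) (mu : 'I_k -> R) : 'I_k :=
  [arg min_(i < i0) mu i]%O.

Definition score {k B : nat} {R : realType} (p : 'I_B -> R) (best : 'I_B -> 'I_k)
  (i : 'I_k) : R := \sum_(b < B) p b * (i == best b)%:R.

Definition Grate {k B : nat} {R : realType} (y lam alpha : 'I_k -> 'I_B -> R)
  (ib : 'I_B -> 'I_k) (i : 'I_k) (b : 'I_B) : R :=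
  if (alpha i b == 0) || (alpha (ib b) b == 0) then 0 else
  (y i b - y (ib b) b) ^+ 2 /
    (2 * (lam i b ^+ 2 / alpha i b + lam (ib b) b ^+ 2 / alpha (ib b) b)).

Definition in_calM {k B : nat} (M : 'M[bool]_(k, B)) : bool :=
  [forall b : 'I_B, (\sum_(i < k) (M i b : nat) == 1)%N].

Definition dgap {k B : nat} {R : realType} (p : 'I_B -> R) (istar j : 'I_k)
  (M : 'M[bool]_(k, B)) : R :=
  \sum_(b < B) p b * (M istar b)%:R - \sum_(b < B) p b * (M j b)%:R.

Definition sumG {k B : nat} {R : realType} (G : 'I_k -> 'I_B -> R)
  (ib : 'I_B -> 'I_k) (M : 'M[bool]_(k, B)) : R :=
  \sum_(i < k) \sum_(b < B | M i b && (i != ib b)) G i b.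

Definition LDR_j {k B : nat} {R : realType} (p : 'I_B -> R) (G : 'I_k -> 'I_B -> R)
  (ib : 'I_B -> 'I_k) (istar j : 'I_k) : \bar R :=
  \big[Order.min/+oo%E]_(M : 'M[bool]_(k, B) | in_calM M && (dgap p istar j M <= 0))
     (sumG G ib M)%:E.

Definition neg_log_rate {R : realType} (n : nat) (pr : \bar R) : \bar R :=
  if pr == 0%E then +oo%E else (- (ln (fine pr)) / n%:R)%:E.

(* Main.v *)
Require Import Defs.
From HB Require Import structures.
From mathcomp Require Import all_boot all_order all_algebra.
From mathcomp Require Import all_classical all_reals all_analysis.
From mathcomp Require Import measurable_realfun ring lra.
Import Order.TTheory GRing.Theory Num.Theory.
Import numFieldNormedType.Exports.
Import HBNNSimple.
Set Implicit Arguments. Unset Strict Implicit. Unset Printing Implicit Defensive.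
Local Open Scope classical_set_scope.
Local Open Scope ring_scope.

(** A false selection forces the empirical best solutions to form one of
    finitely many maps f : 'I_B -> 'I_k with score f istar <= score f j for some
    j <> istar. On the event that f is observed, every difference
    mu_{ib b} - mu_{f b} is nonnegative, hence so is any combination of them with
    weights theta_b >= 0. That combination is linear in the independent normal
    outputs, so a single exponential Markov bound, with
    theta_b = (y_{f b} - y_{ib b}) / V_b and V_b the variance of
    mu_{f b} - mu_{ib b}, gives
    P(f observed) <= exp (- \sum_{b : f b <> ib b} G_{f b}(b)), where G is the rate
    for the weights N_i^n(b). As G is homogeneous of degree 1 and
    lower semicontinuous in the weights, a union bound over f concludes. *)

(** * Change of measure and the normal moment generating function *)

(** Used both with [Z] the density of [nu] and with [Z] a random variable
    independent of [X], where [nu] is the law of [X]. *)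
Lemma ge0_integral_weight {d d'} {T : measurableType d} {T' : measurableType d'}
  {R : realType} (mu : {measure set T -> \bar R}) (nu : {measure set T' -> \bar R})
  (Z : T -> R) (X : T -> T') (c : R) (f : T' -> R) :
  0 <= c -> (forall x, 0 <= Z x) -> measurable_fun setT Z ->
  measurable_fun setT X -> (forall y, 0 <= f y) -> measurable_fun setT f ->
  (forall A, measurable A ->
     (\int[mu]_x (Z x * \1_A (X x))%:E = c%:E * nu A)%E) ->
  (\int[mu]_x (Z x * f (X x))%:E = c%:E * \int[nu]_y (f y)%:E)%E.
Proof.
move=> c0 Z0 mZ mX f0 mf ZA.
have mef : measurable_fun [set: T'] (EFin \o f) by exact/measurable_EFinP.
pose g := nnsfun_approx measurableT mef.
have gf x : EFin \o g ^~ x @ \oo --> (f x)%:E.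
  by apply: cvg_nnsfun_approx => // y _; rewrite lee_fin.
have ndg x a b : (a <= b)%N -> g a x <= g b x.
  by move=> ab; exact/lefP/nd_nnsfun_approx.
have mg n : measurable_fun setT (g n) by exact: measurable_funPT.
have ind r n : measurable_fun setT (\1_(g n @^-1` [set r]) : T' -> R).
  exact: measurable_indic.
(* For a simple function the identity is the hypothesis on sets, summed over the finitely many
   values. *)
have simple n : (\int[mu]_x (Z x * g n (X x))%:E = c%:E * \int[nu]_y (g n y)%:E)%E.
  transitivity (\sum_(k \in range (g n))
     \int[mu]_x (k%:E * (Z x * \1_(g n @^-1` [set k]) (X x))%:E))%E.
    rewrite -ge0_integral_fsum//; last 2 first.
    - move=> r; apply: measurable_funeM; apply/measurable_EFinP.
      by apply: measurable_funM => //; exact: measurableT_comp.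
    - move=> r x _; rewrite EFinM muleCA mule_ge0 ?lee_fin//.
      exact: nnfun_muleindic_ge0.
    apply: eq_integral => x _; rewrite fimfunE EFinM -fsumEFin// ge0_mule_fsumr//.
      by apply: eq_fsbigr => r _; rewrite !EFinM muleCA.
    by move=> r; rewrite EFinM; exact: nnfun_muleindic_ge0.
  transitivity (\sum_(k \in range (g n)) c%:E * (k%:E * nu (g n @^-1` [set k])))%E.
    apply: eq_fsbigr => r /[!inE] -[y _ <-]; rewrite ge0_integralZl_EFin//.
    - by rewrite ZA// muleCA.
    - by move=> x _; rewrite lee_fin mulr_ge0.
    - apply/measurable_EFinP; apply: measurable_funM => //.
      exact: measurableT_comp.
  rewrite -ge0_mule_fsumr; last by move=> r; exact: nnsfun_mulemu_ge0.
  by rewrite integralT_nnsfun sintegralE.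
(* Both integrals are limits along the increasing simple approximations of [f], by monotone
   convergence. *)
have -> : (\int[mu]_x (Z x * f (X x))%:E =
    limn (fun n => \int[mu]_x (Z x * g n (X x))%:E))%E.
  rewrite -monotone_convergence//.
  - apply: eq_integral => x _; apply/esym/cvg_lim => //.
    under eq_fun do rewrite EFinM.
    by rewrite EFinM; apply: cvgeZl => //; exact: gf.
  - move=> n; apply/measurable_EFinP; apply: measurable_funM => //.
    exact: measurableT_comp.
  - by move=> n x _; rewrite lee_fin mulr_ge0.
  - by move=> x _ a b ab; rewrite lee_fin ler_wpM2l// ndg.
have -> : (\int[nu]_y (f y)%:E = limn (fun n => \int[nu]_y (g n y)%:E))%E.
  rewrite -monotone_convergence//.
  - by apply: eq_integral => x _; apply/esym/cvg_lim => //; exact: gf.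
  - by move=> n; apply/measurable_EFinP.
  - by move=> n x _; rewrite lee_fin.
  - by move=> x _ a b ab; rewrite lee_fin ndg.
under eq_fun do rewrite simple.
rewrite limeMl//.
apply: ereal_nondecreasing_is_cvgn => a b ab; apply: ge0_le_integral => //.
- by move=> y _; rewrite lee_fin.
- exact/measurable_EFinP.
- exact/measurable_EFinP.
- by move=> y _; rewrite lee_fin ndg.
Qed.

(** Completing the square: tilting the density by [expR (c * x)] gives the normal density with mean
    [m + c * s ^+ 2], times the constant on the right, and a density integrates to 1. *)
Lemma normal_mgf {R : realType} (m s c : R) : s != 0 ->
  (\int[normal_prob m s]_x (expR (c * x))%:E =
   (expR (c * m + c ^+ 2 * s ^+ 2 / 2))%:E)%E.
Proof.
move=> s0.
have me : measurable_fun setT (fun x : R => expR (c * x)).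
  by apply: measurableT_comp => //; exact: measurable_funM.
have <- : (\int[lebesgue_measure]_x (normal_pdf m s x * expR (c * x))%:E =
    \int[normal_prob m s]_x (expR (c * x))%:E)%E.
  rewrite (@ge0_integral_weight _ _ _ _ _ lebesgue_measure (normal_prob m s)
    (normal_pdf m s) idfun 1 (fun x => expR (c * x)))// ?mul1e//.
  - by move=> x; exact: normal_pdf_ge0.
  - exact: measurable_normal_pdf.
  - exact: measurable_id.
  - move=> A mA; rewrite mul1e /normal_prob [RHS]integral_mkcond.
    apply: eq_integral => x _; rewrite /patch indicE.
    by case: ifPn => _; rewrite ?mulr1 ?mulr0.
transitivity (\int[lebesgue_measure]_x ((expR (c * m + c ^+ 2 * s ^+ 2 / 2))%:E *
   (normal_pdf (m + c * s ^+ 2) s x)%:E))%E.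
  apply: eq_integral => x _; rewrite -EFinM; congr EFin.
  rewrite !normal_pdfE// [RHS]mulrCA -[LHS]mulrA; congr (_ * _).
  rewrite /normal_fun -!expRD; congr expR.
  by rewrite -!(mulr_natr (s ^+ 2)); field.
rewrite ge0_integralZl_EFin ?expR_ge0//.
- by rewrite integral_normal_pdf mule1.
- by move=> x _; rewrite lee_fin normal_pdf_ge0.
- by apply/measurable_EFinP; exact: measurable_normal_pdf.
Qed.

(** * Independence and the exponential Markov bound *)

Lemma indic_preimage_bigcap {T U : Type} {R : realType} (I : choiceType) (s : seq I)
  (X : I -> T -> U) (A : I -> set U) (w : T) :
  \1_(\bigcap_(i in [set` s]) (X i @^-1` A i)) w =
  \prod_(i <- s) \1_(A i) (X i w) :> R.
Proof.
rewrite bigcap_seq; elim: s => [|i s ih]; first by rewrite !big_nil indicT.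
by rewrite !big_cons -ih indicI.
Qed.

Lemma independent_integral_prod {d} {T : measurableType d} {R : realType}
  (P : probability T R) (I : choiceType) (X : I -> T -> R)
  (f : I -> R -> R) (c : I -> R) (s : seq I) :
  mutually_independent P X -> uniq s ->
  (forall i, measurable_fun setT (X i)) ->
  (forall i x, 0 <= f i x) -> (forall i, measurable_fun setT (f i)) ->
  (forall i, \int[P]_w (f i (X i w))%:E = (c i)%:E)%E ->
  (\int[P]_w (\prod_(i <- s) f i (X i w))%:E = (\prod_(i <- s) c i)%:E)%E.
Proof.
move=> indep us mX f0 mf intf.
have c0 i : 0 <= c i.
  by rewrite -lee_fin -intf integral_ge0// => x _; rewrite lee_fin.
pose Y i : {mfun T >-> R} := HB.pack (X i) (isMeasurableFun.Build _ _ _ _ _ (mX i)).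
pose nu i := distribution P (Y i).
have {}intf i : (\int[nu i]_x (f i x)%:E = (c i)%:E)%E.
  rewrite -intf ge0_integral_pushforward//.
  - exact/measurable_EFinP.
  - by move=> x _; rewrite lee_fin.
(* The product rule for sets is the case where every factor is an indicator; the
   induction turns the indicators into the functions [f i] one index at a time. *)
suff H (s' : seq I) (A : I -> set R) : (forall i, measurable (A i)) ->
    uniq (s ++ s') ->
    (\int[P]_w (\prod_(i <- s) f i (X i w) * \prod_(i <- s') \1_(A i) (X i w))%:E
     = (\prod_(i <- s) c i)%:E * \prod_(i <- s') nu i (A i))%E.
  have := H [::] (fun=> setT) (fun=> measurableT).
  by rewrite cats0 big_nil mule1 => <-//; apply: eq_integral => w _; rewrite big_nil mulr1.
elim: s s' A {us} => [|j s ih] s' A mA /=.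
  move=> us'; rewrite big_nil mul1e.
  under eq_integral do rewrite big_nil mul1r -indic_preimage_bigcap.
  rewrite integral_indic//; last first.
    apply: fin_bigcap_measurable => [|i _]; first exact: finite_seq.
    by rewrite -[X in measurable X]setTI; exact: (mX i).
  rewrite setIT.
  exact: (indep s' A us' mA).
move=> /andP[jss' uss'].
have fin_nu : (\prod_(i <- s') nu i (A i))%E \is a fin_num.
  by apply: prode_fin_num => i _; exact: fin_num_measure.
transitivity ((\prod_(i <- s) c i * fine (\prod_(i <- s') nu i (A i)))%:E *
    \int[nu j]_x (f j x)%:E)%E; last first.
  by rewrite big_cons intf !EFinM (fineK fin_nu) muleC muleA.
under eq_integral do rewrite big_cons -mulrA [X in X%:E]mulrC.
(* The weight gathers all factors but the one at [j]. Its integral against an indicator of [X j] is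
   the induction hypothesis with [j] moved to the list of indicators. *)
apply: (@ge0_integral_weight _ _ _ _ _ P (nu j)
  (fun w => \prod_(i <- s) f i (X i w) * \prod_(i <- s') \1_(A i) (X i w))) => //.
- rewrite mulr_ge0//; first exact: prodr_ge0.
  by apply: fine_ge0; apply: prode_ge0 => i _; exact: measure_ge0.
- by move=> w; rewrite mulr_ge0//; apply: prodr_ge0.
- apply: measurable_funM; apply: measurable_prod => i _.
    exact: measurableT_comp.
  by apply: measurableT_comp => //; exact: measurable_indic.
(* Uniqueness keeps [j] out of [s'], so putting [B] at [j] leaves the other indicators unchanged. *)
- move=> B mB; pose A' i := if i == j then B else A i.
  have := ih (j :: s') A'; rewrite !big_cons.
  have -> : (\prod_(i <- s') nu i (A' i))%E = (\prod_(i <- s') nu i (A i))%E.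
    apply: eq_big_seq => i si; rewrite /A'; case: eqP => // ij.
    by move: jss'; rewrite mem_cat -ij si orbT.
  rewrite /A' eqxx => H; rewrite EFinM (fineK fin_nu) -muleA [(_ * nu j B)%E]muleC.
  rewrite -H//.
  + apply: eq_integral => w _; congr EFin; rewrite big_cons eqxx -mulrA; congr (_ * _).
    rewrite mulrC; congr (_ * _); apply: eq_big_seq => i si; case: eqP => // ij.
    by move: jss'; rewrite mem_cat -ij si orbT.
  + by move=> i; case: ifP.
  + by rewrite uniq_catC/= uniq_catC uss' andbT mem_cat orbC -mem_cat.
Qed.

(** On [A] the exponential of the linear combination is at least 1, so it dominates the indicator of
    [A]. By independence its expectation is a product of normal moment generating functions. *)
Lemma chernoff_independent_normal {d} {T : measurableType d} {R : realType}
  (P : probability T R) (I : choiceType) (X : I -> T -> R) (m s c : I -> R)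
  (r : seq I) (A : set T) :
  mutually_independent P X -> uniq r -> (forall i, s i != 0) ->
  (forall i, normally_distributed P (X i) (m i) (s i)) ->
  measurable A -> (forall w, A w -> 0 <= \sum_(i <- r) c i * X i w) ->
  (P A <= (expR (\sum_(i <- r) (c i * m i + c i ^+ 2 * s i ^+ 2 / 2)))%:E)%E.
Proof.
move=> indep ur s0 normX mA A0; rewrite expR_sum.
have mX i : measurable_fun setT (X i) by have [] := normX i.
have me i : measurable_fun setT (fun x : R => expR (c i * x)).
  by apply: measurableT_comp => //; exact: measurable_funM.
rewrite -(@independent_integral_prod _ _ _ P _ X (fun i x => expR (c i * x)))//;
  first last.
- move=> i; rewrite -normal_mgf//.
  (* Weight 1 and constant 1: this transports the expectation over [P] to the law of [X i]. *)
  rewrite -[RHS]mul1e -(@ge0_integral_weight _ _ _ _ _ P (normal_prob (m i) (s i))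
    (cst 1) (X i))//.
    by apply: eq_integral => w _; rewrite mul1r.
  - exact: (mX i).
  - exact: (me i).
  move=> B mB; have [_ lawX] := normX i.
  rewrite mul1e; apply: etrans (lawX B mB).
  under eq_integral do rewrite mul1r.
  by rewrite integral_indic ?setIT// -[X in measurable X]setTI; apply: (mX i).
rewrite -[A]setIT -integral_indic//; apply: ge0_le_integral => //.
- by apply/measurable_EFinP; exact: measurable_indic.
- apply/measurable_EFinP; apply: measurable_prod => i _.
  exact: (measurableT_comp (me i)).
move=> w _; rewrite -expR_sum lee_fin indicE.
case: (boolP (w \in A)) => [/[!inE] Aw|_]; last exact: expR_ge0.
by rewrite -[leLHS]expR0 ler_expR A0.
Qed.

(** * Measurability of the empirical best solutions *)

Lemma measurable_sample_mean {d} {T : measurableType d} {R : realType}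
  (X : nat -> T -> R) (N : nat) : (forall r, measurable_fun setT (X r)) ->
  measurable_fun setT (sample_mean X N).
Proof.
by move=> mX; apply: measurable_funM => //; exact: measurable_sum.
Qed.

(** The event is a finite union, over the accepted truth tables, of finite intersections of
    measurable events. *)
Lemma measurable_bool_ffun {d} {T : measurableType d} (J : finType)
  (q : J -> T -> bool) (Q : {ffun J -> bool} -> bool) :
  (forall j, measurable_fun setT (q j)) ->
  measurable [set w | Q [ffun j => q j w]].
Proof.
move=> mq.
have -> : [set w | Q [ffun j => q j w]] =
    \bigcup_(g in [set g | Q g]) \bigcap_(j in setT) (q j @^-1` [set g j]).
  apply/seteqP; split => [w /= Qw|w [g /= Qg] gw].
    by exists [ffun j => q j w] => //= j _; rewrite /= ffunE.
  suff -> : [ffun j => q j w] = g by [].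
  by apply/ffunP => j; rewrite ffunE; exact: gw.
apply: fin_bigcup_measurable => [|g _]; first exact: finite_finset.
apply: fin_bigcap_measurable => [|j _]; first exact: finite_finset.
by rewrite -[X in measurable X]setTI; exact: mq.
Qed.

Lemma emp_best_le {k : nat} {R : realType} (i0 : 'I_k) (mu : 'I_k -> R) i :
  mu (emp_best i0 mu) <= mu i.
Proof. by rewrite /emp_best; case: arg_minP => // j _; apply. Qed.

(** The arg min, tie-breaking included, is a function of the finite table of pairwise comparisons,
    each of which is a measurable event. *)
Lemma measurable_emp_best {d} {T : measurableType d} {R : realType} (k B : nat)
  (i0 : 'I_k) (mu : 'I_k -> 'I_B -> T -> R) (f : 'I_B -> 'I_k) :
  (forall i b, measurable_fun setT (mu i b)) ->
  measurable [set w | forall b, emp_best i0 (fun i => mu i b w) = f b].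
Proof.
move=> mmu.
pose q (t : 'I_k * 'I_k * 'I_B) w := (mu t.1.1 t.2 w <= mu t.1.2 t.2 w).
(* [F] copies the body of the arg min, with entries of [g] in place of the comparisons. *)
pose F (g : {ffun 'I_k * 'I_k * 'I_B -> bool}) b : 'I_k :=
  odflt i0 [pick i | xpredT i && [forall j, xpredT j ==> g (i, j, b)]].
have FE w b : emp_best i0 (fun i => mu i b w) = F [ffun t => q t w] b.
  rewrite /emp_best /F /Order.arg_min /extremum; congr odflt.
  by apply: eq_pick => i /=; apply: eq_forallb => j; rewrite ffunE.
rewrite (_ : [set w | _] = [set w | [forall b, F [ffun t => q t w] b == f b]]).
  apply: (measurable_bool_ffun (fun g => [forall b, F g b == f b])) => -[[i j] b].
  by apply: measurable_fun_ler.
apply/seteqP; split => w /= H; last by move=> b; rewrite FE; move/forallP: H => /(_ b)/eqP.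
by apply/forallP => b; rewrite -FE H.
Qed.

(** * Probability of a given map of empirical bests *)

Lemma sum_pred1 {R : pzRingType} (I : finType) (a : I) (F : I -> R) :
  \sum_i (i == a)%:R * F i = F a.
Proof.
rewrite (bigD1 a)//= eqxx mul1r big1 ?addr0// => i /negbTE ->.
by rewrite mul0r.
Qed.

(** The bound is non-asymptotic. With the counts as weights, [lam i b ^+ 2 / (N i b)%:R] is the
    variance of a sample mean, so [Grate] is the optimal Chernoff exponent at [b]. *)
Lemma prob_emp_best_le {d} {T : measurableType d} {R : realType}
  (P : probability T R) (k B : nat) (i0 : 'I_k) (y lam : 'I_k -> 'I_B -> R)
  (ib f : 'I_B -> 'I_k) (N : 'I_k -> 'I_B -> nat)
  (X : 'I_k -> 'I_B -> nat -> T -> R) :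
  (forall i b, 0 < lam i b) -> (forall b i, y (ib b) b <= y i b) ->
  (forall i b, (0 < N i b)%N) ->
  (forall i b r, normally_distributed P (X i b r) (y i b) (lam i b)) ->
  mutually_independent P (fun t : 'I_k * 'I_B * nat => X t.1.1 t.1.2 t.2) ->
  (P [set w | forall b, emp_best i0 (fun i => sample_mean (X i b) (N i b) w) = f b]
   <= (expR (- \sum_(b < B | f b != ib b)
         Grate y lam (fun i b => (N i b)%:R) ib (f b) b))%:E)%E.
Proof.
move=> lam0 yib N0 normX indep.
have mX i b r : measurable_fun setT (X i b r) by have [] := normX i b r.
have N0R i b : 0 < (N i b)%:R :> R by rewrite ltr0n.
pose V b : R := lam (f b) b ^+ 2 / (N (f b) b)%:R + lam (ib b) b ^+ 2 / (N (ib b) b)%:R.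
have V0 b : 0 < V b by rewrite addr_gt0// divr_gt0// exprn_gt0.
(* This weight maximizes [theta * D - theta ^+ 2 * V b / 2], with [D] the gap of the two means; the
   maximum is [D ^+ 2 / (2 * V b)]. *)
pose theta b := (y (f b) b - y (ib b) b) / V b.
have theta0 b : 0 <= theta b by rewrite divr_ge0 ?subr_ge0// ltW.
(* Signs of the contrast between [ib b] and [f b]. They cancel when the two coincide, so such a [b]
   adds nothing to the exponent. *)
pose eps i b : R := (i == ib b)%:R - (i == f b)%:R.
pose c (t : 'I_k * 'I_B * nat) : R :=
  theta t.1.2 * eps t.1.1 t.1.2 / (N t.1.1 t.1.2)%:R.
(* All outputs that enter the sample means, each listed once. *)
pose s := [seq (t, r) | t <- enum {: 'I_k * 'I_B}, r <- iota 0 (N t.1 t.2)].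
have us : uniq s.
  apply: allpairs_uniq_dep; first exact: enum_uniq.
    by move=> *; exact: iota_uniq.
  by move=> [t r] [t' r'] _ _ /= [-> ->].
have sum_s F : \sum_(t <- s) F t =
    \sum_(b < B) \sum_(i < k) \sum_(r < N i b) F (i, b, nat_of_ord r) :> R.
  rewrite big_allpairs_dep big_enum/= exchange_big pair_big/=.
  apply: eq_bigr => -[i b] _ /=.
  by rewrite -(big_mkord xpredT (fun r => F (i, b, r))) /index_iota subn0.
have epsE b F : \sum_i eps i b * F i = F (ib b) - F (f b).
  under eq_bigr do rewrite mulrBl.
  by rewrite sumrB !sum_pred1.
apply: (le_trans (chernoff_independent_normal (m := fun t => y t.1.1 t.1.2)
  (s := fun t => lam t.1.1 t.1.2) (c := c) indep us _ _ _ _)).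
- by move=> t; rewrite gt_eqF.
- by move=> t; exact: normX.
- by apply: measurable_emp_best => i b; exact: measurable_sample_mean.
- move=> w /= wf; rewrite sum_s; apply: sumr_ge0 => b _.
  rewrite (_ : \sum_(i < k) _ = theta b * \sum_i eps i b * sample_mean (X i b) (N i b) w).
    rewrite epsE mulr_ge0// subr_ge0 -wf.
    exact: (emp_best_le i0 (fun i => sample_mean (X i b) (N i b) w)).
  rewrite mulr_sumr; apply: eq_bigr => i _.
  rewrite /c /sample_mean/= -mulr_sumr; ring.
rewrite lee_fin ler_expR sum_s -sumrN [leRHS]big_mkcond/=; apply: ler_sum => b _.
(* The square of [eps] is kept as a product so that [epsE] also evaluates the variance term: [V b]
   if [f b] differs from [ib b], and 0 otherwise. *)
have -> : \sum_(i < k) \sum_(r < N i b) (c (i, b, nat_of_ord r) * y i b +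
    c (i, b, nat_of_ord r) ^+ 2 * lam i b ^+ 2 / 2) =
    theta b * (y (ib b) b - y (f b) b) +
    theta b ^+ 2 / 2 * \sum_i eps i b * (eps i b * (lam i b ^+ 2 / (N i b)%:R)).
  rewrite -(epsE b (fun i => y i b)) !mulr_sumr -big_split/=; apply: eq_bigr => i _.
  rewrite /c/= sumr_const card_ord -mulr_natr; field.
  by rewrite gt_eqF.
rewrite epsE /eps !eqxx [f b == _]eq_sym; case: eqVneq => [<-|neq] /=.
  by rewrite !subrr !mulr0 addr0.
rewrite /Grate !gt_eqF//= -/(V b) /theta.
rewrite le_eqVlt; apply/orP; left; apply/eqP.
rewrite (_ : _ - _ * (lam _ _ ^+ 2 / _) = V b); last by rewrite /V; ring.
by field; rewrite gt_eqF.
Qed.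

(** * Lower limits and finite unions *)

Lemma limn_einf_ge {R : realType} (u : (\bar R)^nat) (l : \bar R) :
  (\forall n \near \oo, (l <= u n)%E) -> (l <= limn_einf u)%E.
Proof.
move=> [n0 _ lu]; rewrite limn_einf_lim; apply: lime_ge; first exact: is_cvg_einfs.
exists n0 => // n /= n0n; apply: le_ereal_inf_tmp => _ [m /= nm <-].
by apply: lu; exact: leq_trans nm.
Qed.

Lemma lte_dense_EFin {R : realType} (x y : \bar R) : (x < y)%E ->
  exists r : R, (x < r%:E < y)%E.
Proof.
move: x y => [x| |] [y| |]//=.
- rewrite lte_fin => xy; exists ((x + y) / 2).
  by rewrite !lte_fin midf_lt//= -/(_ < _) midf_lt.
- by move=> _; exists (x + 1); rewrite lte_fin ltrDl ltr01/= ltry.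
- by move=> _; exists (y - 1); rewrite lte_fin ltrBlDr ltrDl ltr01 ltNyr.
- by move=> _; exists 0; rewrite ltNyr ltry.
Qed.

Lemma measure_bigsetU_le {d} {T : measurableType d} {R : realType}
  (mu : {measure set T -> \bar R}) (I : Type) (r : seq I) (Q : pred I)
  (A : I -> set T) : (forall i, measurable (A i)) ->
  (mu (\big[setU/set0]_(i <- r | Q i) A i) <= \sum_(i <- r | Q i) mu (A i))%E.
Proof.
move=> mA; elim: r => [|i r ih]; first by rewrite !big_nil measure0.
rewrite !big_cons; case: ifP => // _.
apply: le_trans (leeD2l _ ih); apply: measureU2 => //.
by apply: bigsetU_measurable => j _.
Qed.

(** * Scaling and lower semicontinuity of the rates *)

Section Grate.
Context {R : realType} {k B : nat}.
Variables (y lam : 'I_k -> 'I_B -> R) (ib : 'I_B -> 'I_k).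
Hypothesis lam0 : forall i b, 0 < lam i b.

Lemma Grate_ge0 alpha i b : (forall i b, 0 <= alpha i b) ->
  0 <= Grate y lam alpha ib i b.
Proof.
move=> a0; rewrite /Grate; case: ifP => // _.
by rewrite divr_ge0 ?sqr_ge0// mulr_ge0// addr_ge0// divr_ge0// sqr_ge0.
Qed.

(** With [c] the budget, this passes from the counts of replications to their fractions. *)
Lemma Grate_div alpha c i b : 0 < c ->
  Grate y lam (fun i b => alpha i b / c) ib i b = Grate y lam alpha ib i b / c.
Proof.
move=> c0; rewrite /Grate !mulf_eq0 invr_eq0 (gt_eqF c0) !orbF.
case: ifP => [_|_]; first by rewrite mul0r.
pose v := lam i b ^+ 2 / alpha i b + lam (ib b) b ^+ 2 / alpha (ib b) b.
rewrite -/v !invf_div.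
rewrite (_ : _ + _ = v * c); last by rewrite /v; ring.
by rewrite mulrA invfM mulrA.
Qed.

(** If one of the two limit weights vanishes, the rate at [alpha] is 0 by convention and
    nonnegativity suffices; otherwise the formula is continuous at [alpha]. *)
Lemma Grate_near_ge (a : nat -> 'I_k -> 'I_B -> R) (alpha : 'I_k -> 'I_B -> R)
  (i : 'I_k) (b : 'I_B) (e : R) :
  (forall i b, 0 <= alpha i b) -> (forall n i b, 0 <= a n i b) ->
  (forall i b, a n i b @[n --> \oo] --> alpha i b) -> 0 < e ->
  \forall n \near \oo,
    Grate y lam alpha ib i b - e <= Grate y lam (a n) ib i b.
Proof.
move=> al0 a0 acvg e0; have := erefl (Grate y lam alpha ib i b).
rewrite {1}/Grate; case: ifPn => [_ <-|].
  by near=> n; rewrite (le_trans _ (Grate_ge0 _ _ (a0 n)))// sub0r oppr_le0 ltW.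
rewrite negb_or => /andP[ai aib]; set g := Grate y lam alpha ib i b => gE.
have Gcvg : (y i b - y (ib b) b) ^+ 2 / (2 * (lam i b ^+ 2 / a n i b +
    lam (ib b) b ^+ 2 / a n (ib b) b)) @[n --> \oo] --> g.
  rewrite -gE.
  apply: cvgM; first exact: cvg_cst.
  apply: cvgV.
    rewrite mulf_neq0// gt_eqF// addr_gt0// divr_gt0 ?exprn_gt0//.
      by rewrite lt_neqAle eq_sym ai al0.
    by rewrite lt_neqAle eq_sym aib al0.
  apply: cvgM; first exact: cvg_cst.
  by apply: cvgD; (apply: cvgM; [exact: cvg_cst|apply: cvgV => //; exact: acvg]).
near=> n.
rewrite /Grate ifF; last first.
  apply/negbTE; rewrite negb_or; apply/andP; split; near: n.
    exact: (cvgr_neq0 _ (acvg i b)).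
  exact: (cvgr_neq0 _ (acvg (ib b) b)).
apply: ltW; near: n; apply: (cvgr_gt _ Gcvg).
by rewrite ltrBlDr ltrDl.
Unshelve. all: by end_near. Qed.

End Grate.

(** * Maps of best solutions as 0-1 matrices *)

(** The graph of [f] as an element of the family over which [LDR_j] minimizes. *)
Definition best_mx {k B : nat} (f : 'I_B -> 'I_k) : 'M[bool]_(k, B) :=
  \matrix_(i, b) (i == f b).

Lemma best_mx_in_calM {k B : nat} (f : 'I_B -> 'I_k) : in_calM (best_mx f).
Proof.
apply/forallP => b; under eq_bigr do rewrite mxE.
by rewrite (bigD1 (f b))//= eqxx big1// => i /negbTE ->.
Qed.

Lemma dgap_best_mx {k B : nat} {R : realType} (p : 'I_B -> R) (i j : 'I_k)
  (f : 'I_B -> 'I_k) : dgap p i j (best_mx f) = score p f i - score p f j.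
Proof. by congr (_ - _); apply: eq_bigr => b _; rewrite mxE. Qed.

Lemma sumG_best_mx {k B : nat} {R : realType} (G : 'I_k -> 'I_B -> R)
  (ib f : 'I_B -> 'I_k) :
  sumG G ib (best_mx f) = \sum_(b < B | f b != ib b) G (f b) b.
Proof.
rewrite /sumG; under eq_bigr do under eq_bigl do rewrite mxE.
rewrite (exchange_big_dep xpredT)//= [RHS]big_mkcond; apply: eq_bigr => b _.
case: ifP => fb; first by apply: big_pred1 => i; rewrite /=; have [->|] := eqVneq i (f b).
by apply: big_pred0 => i; rewrite /=; have [->|] := eqVneq i (f b).
Qed.

(** * From exponential bounds to the decay rate *)

(** Lowering the exponent from [m] to [l] pays for the constant factor [K]. Probability zero has
    rate [+oo]. *)
Lemma neg_log_rate_ge {R : realType} (n : nat) (pr : \bar R) (K m l : R) :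
  (0 < n)%N -> (0 <= pr)%E -> 0 < K -> ln K <= (m - l) * n%:R ->
  (pr <= (K * expR (- (n%:R * m)))%:E)%E -> (l%:E <= neg_log_rate n pr)%E.
Proof.
move=> n0 pr0 K0 lnK prK; rewrite /neg_log_rate; case: eqVneq => [_|prn0].
  exact: leey.
have {prn0} : (0 < pr)%E by rewrite lt_neqAle eq_sym prn0.
case: pr pr0 prK => // r _; rewrite lee_fin lte_fin /= => rK r0.
rewrite lee_fin ler_pdivlMr ?ltr0n// lerNr.
have : ln r <= ln (K * expR (- (n%:R * m))).
  by rewrite ler_ln// posrE mulr_gt0// expR_gt0.
rewrite lnM ?posrE ?expR_gt0// expRK => /le_trans; apply.
by lra.
Qed.

Theorem theorem1 (R : realType) (k B : nat) (hk : (2 <= k)%N)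
  (p : 'I_B -> R) (hp0 : forall b, 0 <= p b) (hp1 : \sum_(b < B) p b = 1)
  (y lam : 'I_k -> 'I_B -> R) (hlam : forall i b, 0 < lam i b)
  (ib : 'I_B -> 'I_k) (hib : forall b i, i != ib b -> y (ib b) b < y i b)
  (istar : 'I_k) (histar : forall j, j != istar -> score p ib j < score p ib istar)
  (alpha : 'I_k -> 'I_B -> R) (ha0 : forall i b, 0 <= alpha i b)
  (ha1 : \sum_(i < k) \sum_(b < B) alpha i b = 1)
  (N : nat -> 'I_k -> 'I_B -> nat)
  (hNa : forall i b, (fun n => (N n i b)%:R / n%:R) @ \oo --> alpha i b)
  (hNoo : forall i b, (fun n => (N n i b)%:R : R) @ \oo --> +oo)
  (d : measure_display) (T : measurableType d) (P : probability T R)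
  (X : 'I_k -> 'I_B -> nat -> T -> R)
  (hXd : forall i b r, normally_distributed P (X i b r) (y i b) (lam i b))
  (hXi : mutually_independent P (fun t : 'I_k * 'I_B * nat => X t.1.1 t.1.2 t.2)) :
  let ibn n b w := emp_best istar (fun i => sample_mean (X i b) (N n i b) w) in
  let E n := [set w | exists j, j != istar /\
                score p (ibn n ^~ w) istar <= score p (ibn n ^~ w) j] in
  (\big[Order.min/+oo%E]_(j | j != istar)
      LDR_j p (Grate y lam alpha ib) ib istar j
   <= limn_einf (fun n => neg_log_rate n (P (E n))))%E.
Proof.
pose ibn n b w := emp_best istar (fun i => sample_mean (X i b) (N n i b) w).
pose E n := [set w | exists j, j != istar /\
  score p (ibn n ^~ w) istar <= score p (ibn n ^~ w) j].
pose L := \big[Order.min/+oo%E]_(j | j != istar)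
  LDR_j p (Grate y lam alpha ib) ib istar j.
change (L <= limn_einf (fun n => neg_log_rate n (P (E n))))%E.
rewrite leNgt; apply/negP.
(* If the inequality failed, a real [l] would lie strictly between the sides. The gap up to a second
   real [l'] below [L] pays for the error in the rates and for the number of maps. *)
move=> /lte_dense_EFin[l /andP[lrhs lL]].
have /lte_dense_EFin[l' /andP[ll' l'L]] := lL; rewrite lte_fin in ll'.
move: lrhs; apply/negP; rewrite -leNgt.
(* The non-strict comparison counts ties as false selections. *)
pose bad (f : {ffun 'I_B -> 'I_k}) : bool :=
  [exists j, (j != istar) && (score p f istar <= score p f j)].
pose A n (f : {ffun 'I_B -> 'I_k}) := [set w | forall b, ibn n b w = f b].
have badG f : bad f -> l' <= \sum_(b < B | f b != ib b) Grate y lam alpha ib (f b) b.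
  move=> /existsP[j /andP[jstar fj]].
  (* [L <= L] is read as a lower bound on each term of the two nested minima, at [j] and at the
     matrix of [f]. *)
  have /bigmin_geP[_ /(_ _ jstar)/bigmin_geP[_ /(_ (best_mx f))]] := lexx L.
  rewrite best_mx_in_calM dgap_best_mx subr_le0 fj sumG_best_mx => /(_ isT).
  by move=> /(lt_le_trans l'L); rewrite lte_fin => /ltW.
have mX i b r : measurable_fun setT (X i b r) by have [] := hXd i b r.
have mA n f : measurable (A n f).
  apply: (@measurable_emp_best _ _ _ _ _ _ (fun i b => sample_mean (X i b) (N n i b))).
  by move=> i b; exact: measurable_sample_mean.
have EA n : E n = \big[setU/set0]_(f | bad f) A n f.
  rewrite -bigcup_seq_cond; apply/seteqP; split => w /=.
    move=> [j [jstar ibnj]]; exists [ffun b => ibn n b w] => [|b]; last by rewrite ffunE.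
    rewrite /= mem_index_enum; apply/existsP; exists j.
    rewrite jstar /score; under eq_bigr do rewrite ffunE.
    by under [leRHS]eq_bigr do rewrite ffunE.
  move=> [f /= /andP[_ /existsP[j /andP[jstar fj]]] Af]; exists j; split => //.
  by rewrite (_ : ibn n ^~ w = f)//; apply/funext.
have yib b i : y (ib b) b <= y i b.
  by have [->//|/hib/ltW] := eqVneq i (ib b).
(* At most [B] rates lose [e] each, hence at most half of the gap in total; the successor keeps the
   denominator nonzero. *)
pose e := (l' - l) / 2 / B.+1%:R.
have e0 : 0 < e by rewrite !divr_gt0 ?subr_gt0.
(* The other half of the gap, [m - l], absorbs [ln K] for large [n]. *)
pose m := (l + l') / 2.
(* Counting all maps, and not only the bad ones, makes [K] positive. *)
pose K : R := #|{ffun 'I_B -> 'I_k}|%:R.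
have K0 : 0 < K by rewrite ltr0n; apply/card_gt0P; exists [ffun=> istar].
have nearN0 : \forall n \near \oo, forall i b, (0 < N n i b)%N.
  apply: filter_forall => i; apply: filter_forall => b.
  by have /cvgryPgt/(_ 0) := hNoo i b; apply: filterS => n; rewrite ltr0n.
have nearG : \forall n \near \oo, forall i b, Grate y lam alpha ib i b - e <=
    Grate y lam (fun i b => (N n i b)%:R / n%:R) ib i b.
  apply: filter_forall => i; apply: filter_forall => b.
  exact: (Grate_near_ge _ _ _ (a := fun n i b => (N n i b)%:R / n%:R)).
apply: limn_einf_ge; near=> n.
have n0 : (0 < n)%N by near: n; exists 1%N.
have N0 : forall i b, (0 < N n i b)%N by near: n.
have Gn : forall i b, Grate y lam alpha ib i b - e <=
    Grate y lam (fun i b => (N n i b)%:R / n%:R) ib i b by near: n.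
apply: (neg_log_rate_ge (K := K) (m := m)) => //.
  rewrite mulrC -ler_pdivrMr; last by rewrite /m; lra.
  by near: n; apply: nbhs_infty_ger.
rewrite EA; apply: le_trans (measure_bigsetU_le _ _ _ (mA n)) _.
apply: (@le_trans _ _ (\sum_(f : {ffun 'I_B -> 'I_k} | bad f) (expR (- (n%:R * m)))%:E)%E).
  apply: lee_sum => f badf.
  apply: le_trans (prob_emp_best_le istar f hlam yib N0 hXd hXi) _.
  rewrite lee_fin ler_expR lerN2 -ler_pdivlMl ?ltr0n//.
  rewrite mulrC mulr_suml.
  (* Homogeneity turns the exponent divided by [n] into the rates at the fractions [N n i b / n],
     which are close to [alpha]. *)
  under eq_bigr do rewrite -Grate_div ?ltr0n//.
  apply: le_trans (ler_sum _ (fun b _ => Gn (f b) b)).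
  rewrite sumrB; apply: (@le_trans _ _ (l' - \sum_(b < B) e)); last first.
    apply: lerB; first exact: badG.
    by rewrite [leLHS]big_mkcond; apply: ler_sum => b _; case: ifP => // _; exact: ltW.
  rewrite sumr_const card_ord -mulr_natl.
  have : B%:R * e <= (l' - l) / 2.
    rewrite /e mulrCA ler_piMr//; first by rewrite divr_ge0// subr_ge0 ltW.
    by rewrite ler_pdivrMr// mul1r ler_nat.
  by rewrite /m; lra.
rewrite sumEFin lee_fin sumr_const -[leLHS]mulr_natl ler_wpM2r ?expR_ge0//.
by rewrite /K ler_nat max_card.
Unshelve. all: by end_near.
Qed.
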